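(* Let $a,k,r$ be integers with $0\le k$, $0<r<a$, and $\gcd(a,r)=1$, and put $b=ak+r$. Let $P$ be an $(a,b)$-Dyck path and $Q=\zeta(P)$. Let $\widetilde\delta(P)\le\delta(P)$ be the number of levels in $P$ that are less than or equal to $a(k+1)$. Let $v_1,\dots,v_{k+1}$ and $h_1,\dots,h_k$ be the lengths of the vertical and horizontal moves of the rational initial bounce path of $Q$, and write $|v|=v_1+\dots+v_{k+1}$ and $|h|=h_1+\dots+h_k$. Then $$\widetilde\delta(P)=|v|+|h|+1$$ and $$|v|+|h|+1\le\delta(P)\le|v|+|h|+r.$$
   Context: Let $a,b$ be relatively prime positive integers. An $(a,b)$-Dyck path is a lattice path from $(0,0)$ to $(b,a)$ with unit north steps and unit east steps, all of whose lattice points $(x,y)$ satisfy $ax\le by$; it is drawn in the grid with $a$ rows and $b$ columns. The level of the lattice point $(x,y)$ is $by-ax$. The levels of $P$ are the levels of the $a+b$ lattice points of $P$ other than the final point $(b,a)$ (these are distinct). $\delta(P)$ is the number of levels of $P$ that are less than $a+b$. Hooks and cores: the unit box with southeast corner $(x,y)$ has hook filling $by-ax$. The positive hooks of $P$ are the positive hook fillings of the boxes of the grid lying below (southeast of) $P$. $\mathfrak{c}(P)$ is the partition whose set of first-column hook lengths is the set of positive hooks of $P$ (it has no hook length equal to $a$ or $b$). For a partition $\kappa$ and a positive integer $m$: for each residue modulo $m$ occurring among the first-column hook lengths of $\kappa$ take the largest such hook length; the rows with these first-column hook lengths are the $m$-rows of $\kappa$; the $m$-boundary is the set of boxes with hook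 length less than $m$. Zeta: $\lambda(P)=(\lambda_1\ge\dots\ge\lambda_a)$ has as parts the numbers of $b$-boundary boxes in the $a$-rows of $\mathfrak{c}(P)$ (padded with zeros). $\zeta(P)$ is the $(a,b)$-Dyck path such that the boxes of the grid above (northwest of) it form the Young diagram of $\lambda(P)$ (English notation). Rational initial bounce path of an $(a,ak+r)$-Dyck path $Q$: a sequence of alternating $k+1$ vertical moves (lengths $v_1,\dots,v_{k+1}\ge0$) and $k$ horizontal moves (lengths $h_1,\dots,h_k$), starting at $(0,0)$ with a vertical move and ending with the $(k+1)$-th vertical move. For each $i$, from the current position move north $v_i$ steps until reaching an east step of $Q$ (i.e. until reaching the initial lattice point of the east step of $Q$ starting on the current vertical line); then, if $i\le k$, move east $h_i=v_1+\dots+v_i$ steps. *)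

(* Defs.v *)
From HB Require Import structures.
From mathcomp Require Import all_boot all_order all_algebra.

Set Implicit Arguments.
Unset Strict Implicit.
Unset Printing Implicit Defensive.

Import Order.TTheory GRing.Theory Num.Theory.

Variant step := North | East.

Definition bool_of_step s := if s is North then true else false.
Definition step_of_bool (c : bool) := if c then North else East.
Lemma bool_of_stepK : cancel bool_of_step step_of_bool. Proof. by case. Qed.
HB.instance Definition _ := Finite.copy step (can_type bool_of_stepK).

(* A lattice path from (0,0) is its word of steps; [point w i] is the lattice
   point (x, y) reached after the first [i] steps. *)
Definition point (w : seq step) (i : nat) : nat * nat :=
  (count_mem East (take i w), count_mem North (take i w)).

Definition dyck_path (a b : nat) (w : seq step) : bool :=
  [&& count_mem North w == a, count_mem East w == b &
      all (fun i => a * (point w i).1 <= b * (point w i).2)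
          (iota 0 (size w).+1)].

Definition level (a b : nat) (p : nat * nat) : int :=
  ((b * p.2)%N%:Z - (a * p.1)%N%:Z)%R.

(* The final lattice point, of index [size w], is excluded. *)
Definition levels (a b : nat) (w : seq step) : seq int :=
  [seq level a b (point w i) | i <- iota 0 (size w)].

Definition delta (a b : nat) (w : seq step) : nat :=
  count (fun l : int => (l < (a + b)%N%:Z)%R) (levels a b w).

(* For b = a * k + r; [k] is kept as a separate argument. *)
Definition delta_tilde (a b k : nat) (w : seq step) : nat :=
  count (fun l : int => (l <= (a * k.+1)%N%:Z)%R) (levels a b w).

(* Entry number [x] is the height of the east step from abscissa [x] to
   [x.+1]. *)
Definition east_heights (w : seq step) : seq nat :=
  [seq (point w i).2 | i <- iota 0 (size w) & nth North w i == East].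

(* Entry number [y] is the abscissa of the north step in the [y]-th grid row
   from the bottom, that is, the number of boxes of that row lying northwest of
   the path. *)
Definition north_abscissas (w : seq step) : seq nat :=
  [seq (point w i).1 | i <- iota 0 (size w) & nth East w i == North].

(* Boxes are named by their southeast corner (x, y), with 1 <= x <= b and
   0 <= y < a; such a box is below the path when it lies under the east step
   from abscissa [x.-1] to [x]. *)
Definition boxes_below (a b : nat) (w : seq step) : seq (nat * nat) :=
  [seq p <- [seq (x, y) | x <- iota 1 b, y <- iota 0 a]
     | p.2 < nth 0 (east_heights w) p.1.-1].

Definition positive_hooks (a b : nat) (w : seq step) : seq nat :=
  [seq absz (level a b p) | p <- boxes_below a b w & (0 < level a b p)%R].

(* Integer partitions are nonincreasing sequences of positive integers; rows
   and columns of the Young diagram are numbered from 0. *)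
Definition is_partition (kappa : seq nat) : bool :=
  sorted geq kappa && all (leq 1) kappa.

Definition column_length (kappa : seq nat) (j : nat) : nat :=
  count (fun p => j < p) kappa.

Definition hook_length (kappa : seq nat) (i j : nat) : nat :=
  ((nth 0 kappa i - j.+1) + (column_length kappa j - i.+1)).+1.

Definition first_column_hooks (kappa : seq nat) : seq nat :=
  [seq hook_length kappa i 0 | i <- iota 0 (size kappa)].

(* The partition with first-column hook lengths [H] (see
   [partition_of_hooksP]
   and [partition_of_hooks_unique]): if h_0 > ... > h_(n-1) are the elements of [H], then
   the leg of the first box of row [i] is n - i - 1, so the part is
   h_i - (n - i - 1). *)
Definition partition_of_hooks (H : seq nat) : seq nat :=
  let s := sort geq H in
  [seq nth 0 s i - (size s - i.+1) | i <- iota 0 (size s)].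

Lemma partition_of_hooksP (H : seq nat) :
  uniq H -> all (leq 1) H ->
  is_partition (partition_of_hooks H) /\
  perm_eq (first_column_hooks (partition_of_hooks H)) H.
Proof.
move=> uH posH; pose s := sort geq H.
have geq_tr : transitive geq by move=> x y z /= xy yz; apply: leq_trans yz xy.
have geq_tot : total geq by move=> x y; apply: leq_total.
have ps : all (leq 1) s by rewrite all_sort.
have us : uniq s by rewrite sort_uniq.
have ss : sorted geq s by apply: sort_sorted.
have lt_s i j : i < j -> j < size s -> nth 0 s j < nth 0 s i.
  move=> ij js; have is_ := ltn_trans ij js.
  rewrite ltn_neqAle nth_uniq // gtn_eqF //=.
  by apply: (sorted_ltn_nth geq_tr).
have bound d i : i + d.+1 = size s -> d < nth 0 s i.
  elim: d i => [|d IH] i e.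
    by apply: (allP ps); apply: mem_nth; rewrite -e addn1.
  apply: (leq_ltn_trans (IH i.+1 _)); first by rewrite addSnnS.
  by apply: lt_s; rewrite // -e -addn2 leq_add2l.
pose k := partition_of_hooks H.
have szk : size k = size s by rewrite size_map size_iota.
have nthk i : i < size s -> nth 0 k i = nth 0 s i - (size s - i.+1).
  by move=> lti; rewrite (nth_map 0) ?size_iota // nth_iota.
have boundk i : i < size s -> size s - i.+1 < nth 0 s i.
  by move=> lti; apply: bound; rewrite subnSK // subnKC // ltnW.
have posk : all (leq 1) k.
  by apply/(all_nthP 0) => i; rewrite szk => lti; rewrite nthk // subn_gt0 boundk.
split.
  rewrite /is_partition posk andbT; apply/(sortedP 0) => i; rewrite szk => lti /=.
  rewrite !nthk ?(ltnW lti) // -[size s - i.+1]subnSK //.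
  rewrite [leqRHS]subnS predn_sub.
  apply: leq_sub2r; have lt := lt_s _ _ (ltnSn i) lti.
  by rewrite -ltnS prednK // (leq_trans _ lt).
have -> : first_column_hooks k = s.
  apply: (@eq_from_nth _ 0); rewrite size_map size_iota //= => i.
  rewrite szk => lti; rewrite (nth_map 0) ?size_iota ?szk // nth_iota ?szk //.
  rewrite add0n /hook_length nthk //.
  have -> : column_length k 0 = size s by rewrite -szk; apply/eqP; rewrite -all_count.
  have := boundk i lti; set d := size s - i.+1 => hd.
  rewrite subn1 -addSn prednK ?subn_gt0 // subnK //.
  exact: ltnW.
by rewrite perm_sort.
Qed.

Lemma partition_of_hooks_unique (kappa H : seq nat) :
  is_partition kappa -> perm_eq (first_column_hooks kappa) H ->
  kappa = partition_of_hooks H.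
Proof.
case/andP=> sk pk pH.
have geq_tr : transitive geq by move=> x y z /= xy yz; apply: leq_trans yz xy.
have geq_anti : antisymmetric geq.
  by move=> x y /andP[yx xy]; apply/eqP; rewrite eqn_leq; apply/andP.
have geq_tot : total geq by move=> x y; apply: leq_total.
have szF : size (first_column_hooks kappa) = size kappa.
  by rewrite size_map size_iota.
have nthF i : i < size kappa -> nth 0 (first_column_hooks kappa) i
    = nth 0 kappa i + (size kappa - i.+1).
  move=> lti; rewrite (nth_map 0) ?size_iota // nth_iota // add0n /hook_length.
  have -> : column_length kappa 0 = size kappa by apply/eqP; rewrite -all_count.
  by rewrite subn1 -addSn prednK //; apply: (allP pk); apply: mem_nth.
have sF : sorted geq (first_column_hooks kappa).
  apply/(sortedP 0) => i; rewrite szF => lti /=.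
  rewrite !nthF ?(ltnW lti) //; apply: leq_add; last exact: leq_sub2l.
  exact: (sortedP 0 sk).
have sE : sort geq H = first_column_hooks kappa.
  apply: (sorted_eq geq_tr geq_anti (sort_sorted geq_tot H) sF).
  by rewrite perm_sort perm_sym.
rewrite /partition_of_hooks sE szF.
apply: (@eq_from_nth _ 0) => [|i lti]; first by rewrite size_map size_iota.
by rewrite (nth_map 0) ?size_iota // nth_iota // add0n nthF // addnK.
Qed.

Definition core (a b : nat) (w : seq step) : seq nat :=
  partition_of_hooks (positive_hooks a b w).

Definition m_rows (m : nat) (kappa : seq nat) : seq nat :=
  [seq i <- iota 0 (size kappa) |
    all (fun i' => (hook_length kappa i' 0 == hook_length kappa i 0 %[mod m])
                   ==> (hook_length kappa i' 0 <= hook_length kappa i 0))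
        (iota 0 (size kappa))].

Definition boundary_boxes (m : nat) (kappa : seq nat) (i : nat) : nat :=
  count (fun j => hook_length kappa i j < m) (iota 0 (nth 0 kappa i)).

Definition lambda (a b : nat) (w : seq step) : seq nat :=
  let kappa := core a b w in
  let s := sort geq [seq boundary_boxes b kappa i | i <- m_rows a kappa] in
  s ++ nseq (a - size s) 0.

(* [s] lists the abscissas of the north steps still to be made, from bottom to
   top, the current abscissa being [x]. *)
Fixpoint path_of_abscissas (b x : nat) (s : seq nat) : seq step :=
  if s is l :: s' then
    nseq (l - x) East ++ North :: path_of_abscissas b l s'
  else nseq (b - x) East.

(* The lattice path with the Young diagram of [la] (English notation, so the
   last part is the bottom row) to its northwest; see [north_abscissas_path]. *)
Definition path_of_partition (b : nat) (la : seq nat) : seq step :=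
  path_of_abscissas b 0 (rev la).

Lemma north_abscissas_cons s w :
  north_abscissas (s :: w) =
  (if s is North then [:: 0] else [::])
    ++ [seq (s == East) + x | x <- north_abscissas w].
Proof.
have E : [seq (point (s :: w) i).1 |
            i <- iota 1 (size w) & nth East (s :: w) i == North]
         = [seq (s == East) + x | x <- north_abscissas w].
  by rewrite -[1]addn0 iotaDl filter_map -!map_comp; apply: eq_map.
by rewrite /north_abscissas /= -E; case: (s).
Qed.

Lemma north_abscissas_path (b : nat) (la : seq nat) :
  sorted geq la -> all (leq^~ b) la ->
  let w := path_of_partition b la in
  [/\ count_mem North w = size la, count_mem East w = b
    & north_abscissas w = rev la].
Proof.
move=> sla ble /=; rewrite -(size_rev la) /path_of_partition.
have {ble} : all (leq^~ b) (rev la) by rewrite all_rev.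
have {sla} : path leq 0 (rev la) by rewrite path_min_sorted ?rev_sorted //; apply/allP.
have catE n w : north_abscissas (nseq n East ++ w)
    = [seq n + x | x <- north_abscissas w].
  elim: n => [|n IH] /=; first by rewrite (eq_map (g := id)) ?map_id.
  by rewrite north_abscissas_cons IH /= -map_comp; apply: eq_map.
suff main : forall s x, x <= b -> path leq x s -> all (leq^~ b) s ->
    let w := path_of_abscissas b x s in
    [/\ count_mem North w = size s, count_mem East w = b - x
      & north_abscissas w = [seq y - x | y <- s]].
  move=> h1 h2; have [-> -> ->] := main _ _ (leq0n b) h1 h2.
  split=> //; first by rewrite subn0.
  by rewrite -[RHS]map_id; apply: eq_map => x; rewrite subn0.
elim=> [|l s IH] x xb /=.
  move=> _ _; rewrite !count_nseq mul0n mul1n; split=> //.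
  by rewrite -[nseq _ _]cats0 catE.
case/andP=> xl ps /andP[lb bs]; have [n1 n2 n3] := IH l lb ps bs.
rewrite !count_cat !count_nseq /= n1 n2 mul0n mul1n !add0n; split=> //.
  by rewrite addnC addnBA // subnK.
rewrite catE north_abscissas_cons n3 /= addn0; congr cons.
rewrite -!map_comp; apply/eq_in_map => y ys /=.
have ly : l <= y by apply: (allP (order_path_min leq_trans ps)).
by rewrite add0n addnC addnBA // subnK.
Qed.

Definition zeta (a b : nat) (w : seq step) : seq step :=
  path_of_partition b (lambda a b w).

(* Given the vertical moves [v], the horizontal moves h_1, ..., h_n with
   h_i = v_1 + ... + v_i. *)
Definition horizontal_moves (n : nat) (v : seq nat) : seq nat :=
  [seq sumn (take i v) | i <- iota 1 n].

(* The first [n] vertical moves of the initial bounce path of [w]. After [m]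
   vertical and [m] horizontal moves the path is at (|h|, |v|), and then goes
   north to the start of the east step of [w] on the line x = |h|. For
   n <= k + 1 that line satisfies |h| <= a * k < b, so the east step exists;
   heights of east steps increase, so the subtraction is not truncated. *)
Fixpoint vertical_moves (w : seq step) (n : nat) : seq nat :=
  if n is m.+1 then
    let v := vertical_moves w m in
    let h := horizontal_moves m v in
    rcons v (nth 0 (east_heights w) (sumn h) - sumn v)
  else [::].

(* Main.v *)
Require Import Defs.
From mathcomp Require Import all_boot all_order all_algebra.
From mathcomp Require Import zify.

Set Implicit Arguments.
Unset Strict Implicit.
Unset Printing Implicit Defensive.

(** The theorem holds because [zeta] is a sweep map: it lists the steps of the
    path by increasing level of their starting points, and the bounce path reads
    off how many levels lie below each multiple of [a].

    Call a natural number a gap when it is not a positive hook of the path P.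
    Adding [a] or [b] to a gap gives a gap. The levels at which north steps
    start are the smallest gaps of their residue classes modulo [a], and the levels at
    which east steps end are the smallest gaps of their classes modulo [b]
    ([mem_north_levels], [mem_east_ends]). In the row of the core with
    first-column hook h the hook lengths are the numbers h - g with g < h a gap
    ([perm_row_hooks]), and the first-column hooks of the [a]-rows are the
    numbers n - [a] with n > [a] a north level. Hence the part of [lambda]
    coming from n counts the classes modulo [b] having a gap below n - [a], that is,
    the east steps of P that start at a level below n ([perm_lambda]).

    An interval of length [a] ending before x contains exactly one gap for each
    north level below x ([count_window]). Moreover [a * i] < [b] is a gap, hence
    ends an east step that starts at level [a * i.+1]. In [zeta] this east step
    lies on the line whose abscissa is the number of gaps below [a * i], and the
    north steps before it are those of level below [a * i.+1]
    ([zeta_height_gaps]). By induction, after i moves of each kind the bounce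
    path has made as many north steps as there are north levels below [a * i],
    and as many east steps as there are gaps below [a * i] ([bounce_path]). The
    levels up to [a * k.+1] are then the |v| north levels together with
    |h| + 1 east levels, one for each gap up to [a * k]. Finally, the levels are
    distinct and only r - 1 integers lie strictly between [a * k.+1] and
    [a + b], which bounds [delta]. *)

(** * North and east steps of a word *)

Definition step_points (c : step) (w : seq step) : seq (nat * nat) :=
  [seq point w i | i <- iota 0 (size w) & nth c w i == c].

(** The displacement of the points of a word when [s] is put in front of it. *)
Definition shift (s : step) (p : nat * nat) : nat * nat :=
  ((s == East) + p.1, (s == North) + p.2).

Lemma step_points_cons c s w :
  step_points c (s :: w) =
  (if s == c then [:: (0, 0)] else [::])
    ++ [seq shift s p | p <- step_points c w].
Proof.
have E : [seq point (s :: w) i | i <- iota 1 (size w) & nth c (s :: w) i == c]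
         = [seq shift s p | p <- step_points c w].
  by rewrite -[1]addn0 iotaDl filter_map -!map_comp; apply: eq_map.
by rewrite /step_points /= -E; case: (s == c).
Qed.

Lemma north_abscissasE w :
  north_abscissas w = [seq p.1 | p <- step_points North w].
Proof.
rewrite /north_abscissas /step_points -map_comp; congr map.
apply: eq_in_filter => i; rewrite mem_iota => /= iw.
by rewrite (set_nth_default North).
Qed.

Lemma east_heightsE w : east_heights w = [seq p.2 | p <- step_points East w].
Proof.
rewrite /east_heights /step_points -map_comp; congr map.
apply: eq_in_filter => i; rewrite mem_iota => /= iw.
by rewrite (set_nth_default East).
Qed.

Lemma north_ordinates w :
  [seq p.2 | p <- step_points North w] = iota 0 (count_mem North w).
Proof.
elim: w => //= s w IH; rewrite step_points_cons map_cat -map_comp.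
have -> : [seq (snd \o shift s) p | p <- step_points North w]
   = [seq (s == North) + y | y <- [seq p.2 | p <- step_points North w]].
  by rewrite -map_comp.
by rewrite IH -iotaDl; case: s.
Qed.

Lemma east_abscissas w :
  [seq p.1 | p <- step_points East w] = iota 0 (count_mem East w).
Proof.
elim: w => //= s w IH; rewrite step_points_cons map_cat -map_comp.
have -> : [seq (fst \o shift s) p | p <- step_points East w]
   = [seq (s == East) + y | y <- [seq p.1 | p <- step_points East w]].
  by rewrite -map_comp.
by rewrite IH -iotaDl; case: s.
Qed.

Lemma size_step_points c w : size (step_points c w) = count_mem c w.
Proof.
case: c; first by rewrite -(size_map snd) north_ordinates size_iota.
by rewrite -(size_map fst) east_abscissas size_iota.
Qed.

Lemma size_north_abscissas w : size (north_abscissas w) = count_mem North w.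
Proof. by rewrite north_abscissasE size_map size_step_points. Qed.

Lemma size_east_heights w : size (east_heights w) = count_mem East w.
Proof. by rewrite east_heightsE size_map size_step_points. Qed.

Lemma east_heights_cons s w :
  east_heights (s :: w) =
  (if s is East then [:: 0] else [::])
    ++ [seq (s == North) + y | y <- east_heights w].
Proof.
rewrite !east_heightsE step_points_cons map_cat -!map_comp.
by case: s.
Qed.

(** The north steps below the east step leaving the line x = j are those made on
    the lines x = 0, ..., j. *)
Lemma nth_east_heights w j : j < count_mem East w ->
  nth 0 (east_heights w) j = count (leq^~ j) (north_abscissas w).
Proof.
elim: w j => //= s w IH j; rewrite east_heights_cons north_abscissas_cons.
case: s => /= jw; rewrite count_map.
  by rewrite (nth_map 0) ?size_east_heights // IH.
case: j jw => [|j] jw /=; first by rewrite (@eq_count _ _ pred0) ?count_pred0.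
by rewrite (nth_map 0) ?size_east_heights // IH.
Qed.

Lemma sorted_north_abscissas w : sorted leq (north_abscissas w).
Proof.
elim: w => //= s w IH; rewrite north_abscissas_cons.
have sw : sorted leq [seq (s == East) + x | x <- north_abscissas w].
  by rewrite sorted_map; apply: sub_sorted IH => x y /=; rewrite leq_add2l.
by case: (s) sw => //= sw; rewrite path_min_sorted //; apply/allP.
Qed.

Lemma sorted_count_leq (s : seq nat) i x : sorted leq s -> i < size s ->
  (i < count (leq^~ x) s) = (nth 0 s i <= x).
Proof.
elim: s i => //= y s IH i ys.
have ss := path_sorted ys.
have /allP min_y := order_path_min leq_trans ys.
case: (leqP y x) => yx.
  case: i => [|i] si /=; first by rewrite yx.
  by rewrite add1n ltnS IH.
rewrite (_ : count _ s = 0).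
  case: i => [|i] si /=; first lia.
  have := min_y _ (mem_nth 0 (si : i < size s)); rewrite /= => ?; lia.
apply/eqP; rewrite -leqn0 leqNgt -has_count; apply/hasPn => z /min_y /=; lia.
Qed.

(** Whether the box in row y and column j + 1 lies below the path can be read
    off from its row or from its column. *)
Lemma north_east_transpose w y j :
  y < count_mem North w -> j < count_mem East w ->
  (y < nth 0 (east_heights w) j) = (nth 0 (north_abscissas w) y <= j).
Proof.
move=> yw jw; rewrite nth_east_heights // sorted_count_leq //.
  exact: sorted_north_abscissas.
by rewrite size_north_abscissas.
Qed.

Lemma nth_north_points w y : y < count_mem North w ->
  nth (0, 0) (step_points North w) y = (nth 0 (north_abscissas w) y, y).
Proof.
move=> yw; rewrite north_abscissasE (nth_map (0, 0)) ?size_step_points //.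
have : nth 0 [seq p.2 | p <- step_points North w] y = y.
  by rewrite north_ordinates nth_iota.
by rewrite (nth_map (0, 0)) ?size_step_points //; case: nth => x y' /= ->.
Qed.

Lemma nth_east_points w x : x < count_mem East w ->
  nth (0, 0) (step_points East w) x = (x, nth 0 (east_heights w) x).
Proof.
move=> xw; rewrite east_heightsE (nth_map (0, 0)) ?size_step_points //.
have : nth 0 [seq p.1 | p <- step_points East w] x = x.
  by rewrite east_abscissas nth_iota.
by rewrite (nth_map (0, 0)) ?size_step_points //; case: nth => x' y /= ->.
Qed.

Lemma perm_step_points w :
  perm_eq [seq point w i | i <- iota 0 (size w)]
          (step_points North w ++ step_points East w).
Proof.
rewrite -map_cat; apply: perm_map.
rewrite -(perm_filterC (fun i => nth North w i == North)) perm_sym.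
have -> // : [seq i <- iota 0 (size w) | nth East w i == East]
  = [seq i <- iota 0 (size w) | predC (fun i => nth North w i == North) i].
apply: eq_in_filter => i; rewrite mem_iota => /= iw.
by rewrite (set_nth_default North) //; case: nth.
Qed.

(** * Sets closed under a translation *)

Section Firsts.
Variables (m : nat) (p : pred nat).
Hypothesis p_closed : forall g, p g -> p (g + m).

Definition first_in_class (g : nat) : bool :=
  p g && ((m <= g) ==> ~~ p (g - m)).

Lemma closed_iter t g : p g -> p (g + t * m).
Proof.
elim: t => [|t IH] pg; first by rewrite addn0.
by rewrite mulSn addnCA addnC p_closed // IH.
Qed.

(** By the pigeonhole principle [F] meets every residue class, and a class has
    only one first element. *)
Lemma firsts_complete F : 0 < m -> size F = m -> uniq [seq f %% m | f <- F] ->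
  all first_in_class F -> forall g, (g \in F) = first_in_class g.
Proof.
move=> m_gt0 szF uF /allP F1 g; apply/idP/idP => [/F1 //|].
have sub : {subset [seq f %% m | f <- F] <= iota 0 m}.
  by move=> _ /mapP[f _ ->]; rewrite mem_iota /= ltn_pmod.
have Fm : [seq f %% m | f <- F] =i iota 0 m.
  by have [|_] := uniq_min_size uF sub; rewrite ?size_map ?size_iota ?szF.
have := Fm (g %% m); rewrite mem_iota /= ltn_pmod // => /mapP[f fF gf].
case/andP: (F1 f fF) => pf /implyP nf /andP[pg /implyP ng].
case: (ltngtP f g) => [fg|gf'|<- //]; last first.
  have [t ft] : exists t, f = g + t.+1 * m.
    have : g = f %[mod m] by [].
    move/eqP; rewrite eq_sym eqn_mod_dvd; last by rewrite ltnW.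
    case/dvdnP=> [[|t] e]; [exfalso; lia | exists t; lia].
  have mf : m <= f by rewrite ft mulSn; lia.
  have := nf mf; rewrite ft mulSn addnCA addnC addnK closed_iter //.
have [t ft] : exists t, g = f + t.+1 * m.
  move/eqP: gf; rewrite eqn_mod_dvd; last by rewrite ltnW.
  case/dvdnP=> [[|t] e]; [exfalso; lia | exists t; lia].
have mf : m <= g by rewrite ft mulSn; lia.
have := ng mf; rewrite ft mulSn addnCA addnC addnK closed_iter //.
Qed.

Variable F : seq nat.
Hypothesis uF : uniq F.
Hypothesis F_first : forall g, (g \in F) = first_in_class g.

Lemma count_ltnS x :
  count (ltn^~ x.+1) F = count (ltn^~ x) F + first_in_class x.
Proof.
rewrite -[first_in_class x]F_first -count_uniq_mem //.
elim: (F) => //= f s ->; case: (ltngtP f x) => //; lia.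
Qed.

Lemma count_iotaS x : count p (iota 0 x.+1) = count p (iota 0 x) + p x.
Proof. by rewrite -addn1 iotaD count_cat /= addn0. Qed.

Lemma count_below x : x <= m -> count p (iota 0 x) = count (ltn^~ x) F.
Proof.
elim: x => [|x IH] xm; first by elim: (F).
rewrite count_iotaS count_ltnS IH ?(ltnW xm) //.
by rewrite /first_in_class leqNgt xm andbT.
Qed.

(** An interval of length [m] ending before [x + m] contains exactly one element
    of each class whose first element is below [x + m]. *)
Lemma count_window x :
  count p (iota 0 (x + m)) = count p (iota 0 x) + count (ltn^~ (x + m)) F.
Proof.
elim: x => [|x IH]; first by rewrite count_below.
rewrite addSn !count_iotaS count_ltnS IH.
rewrite /first_in_class leq_addl addnK /=.
have := @p_closed x; case: (p x) => [->//|_]; lia.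
Qed.
End Firsts.

(** * Hooks of a partition *)

Lemma column_length_leq kappa j : column_length kappa j <= size kappa.
Proof. exact: count_size. Qed.

Lemma ltn_column_length kappa i j : sorted geq kappa -> i < size kappa ->
  (i < column_length kappa j) = (j < nth 0 kappa i).
Proof.
have geq_tr : transitive geq by move=> x y z /= xy yz; apply: leq_trans yz xy.
rewrite /column_length; elim: kappa i => //= y s IH i ys si.
have ss := path_sorted ys.
have /allP max_y := order_path_min geq_tr ys.
case: (ltnP j y) => yj.
  case: i si => [|i] si /=; first by rewrite yj.
  by rewrite add1n ltnS IH.
rewrite (_ : count _ s = 0).
  case: i si => [|i] si /=; first lia.
  have /= := max_y _ (mem_nth 0 (si : i < size s)); lia.
apply/eqP; rewrite -leqn0 leqNgt -has_count; apply/hasPn => z /max_y /=; lia.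
Qed.

Lemma first_column_hook kappa i : is_partition kappa -> i < size kappa ->
  hook_length kappa i 0 = nth 0 kappa i + (size kappa - i.+1).
Proof.
case/andP=> _ pk ik; have /= := allP pk _ (mem_nth 0 ik).
have c0 : column_length kappa 0 = size kappa by apply/eqP; rewrite -all_count.
by rewrite /hook_length c0 /=; lia.
Qed.

Lemma sorted_geq_nth kappa i j : sorted geq kappa -> i <= j ->
  nth 0 kappa j <= nth 0 kappa i.
Proof.
move=> sk ij; case: (ltnP j (size kappa)) => jk; last by rewrite nth_default.
have geq_tr : transitive geq by move=> x y z /= xy yz; apply: leq_trans yz xy.
have geq_refl : reflexive geq by move=> x /=.
by apply: (sorted_leq_nth geq_tr geq_refl 0 sk) => //; rewrite inE; lia.
Qed.

Lemma uniq_first_column_hooks kappa : is_partition kappa ->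
  uniq (first_column_hooks kappa).
Proof.
move=> pk; have /andP[sk _] := pk; rewrite map_inj_in_uniq ?iota_uniq // => i j.
rewrite !mem_iota /= => ik jk; rewrite !first_column_hook //.
case: (ltngtP i j) => // ij.
  by have := sorted_geq_nth sk (ltnW ij); lia.
by have := sorted_geq_nth sk (ltnW ij); lia.
Qed.

(** The column [j] corresponds to the gap j + (number of rows of length at most
    j), which is where a lattice walk along the rim makes its [j]-th horizontal
    step. It precedes the first-column hook h of row i exactly when the box
    (i, j) is present, and the distance from it to h is the hook length of the
    box. A counting argument shows that all gaps below h arise. *)
Lemma perm_row_hooks kappa i : is_partition kappa -> i < size kappa ->
  perm_eq [seq hook_length kappa i j | j <- iota 0 (nth 0 kappa i)]
          [seq hook_length kappa i 0 - g | g <- iota 0 (hook_length kappa i 0)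
             & g \notin first_column_hooks kappa].
Proof.
move=> pk ik; set h := hook_length kappa i 0; have /andP[sk _] := pk.
have hE : h = nth 0 kappa i + (size kappa - i.+1) by apply: first_column_hook.
pose gap j := j + (size kappa - column_length kappa j).
have cl := column_length_leq kappa.
have gapE j : j < nth 0 kappa i ->
    gap j < h /\ hook_length kappa i j = h - gap j.
  move=> jk; have := cl j; have := jk; rewrite -ltn_column_length //.
  by rewrite hE /hook_length /gap; lia.
have mono j j' : j < j' -> gap j < gap j'.
  move=> jj; have : column_length kappa j' <= column_length kappa j.
    by apply: sub_count => x /=; lia.
  by have := cl j; have := cl j'; rewrite /gap; lia.
have gapN j : gap j \notin first_column_hooks kappa.
  apply/negP => /mapP[i']; rewrite mem_iota /= => ik'.
  rewrite first_column_hook // /gap; have := cl j.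
  by have := ltn_column_length j sk ik'; case: ltnP; lia.
have -> : [seq hook_length kappa i j | j <- iota 0 (nth 0 kappa i)]
    = [seq h - g | g <- [seq gap j | j <- iota 0 (nth 0 kappa i)]].
  rewrite -map_comp; apply/eq_in_map => j; rewrite mem_iota /= => jk.
  by case: (gapE j jk).
apply: perm_map.
have ug : uniq [seq gap j | j <- iota 0 (nth 0 kappa i)].
  rewrite map_inj_in_uniq ?iota_uniq // => j j' _ _ e.
  by case: (ltngtP j j') => // /mono; lia.
have sg : {subset [seq gap j | j <- iota 0 (nth 0 kappa i)]
    <= [seq g <- iota 0 h | g \notin first_column_hooks kappa]}.
  move=> _ /mapP[j jk ->]; rewrite mem_iota /= in jk; case: (gapE j jk) => gh _.
  by rewrite mem_filter gapN mem_iota.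
apply: uniq_perm => //; first by rewrite filter_uniq ?iota_uniq.
have [|_] := uniq_min_size ug sg; last by [].
(* The first-column hooks of the rows after i are distinct and below h. *)
have : size kappa - i.+1 <= count (mem (first_column_hooks kappa)) (iota 0 h).
  rewrite -size_filter -(size_iota i.+1 (_ - _)).
  rewrite -(size_map (fun i' => hook_length kappa i' 0)).
  apply: uniq_leq_size => [|_ /mapP[i' ii' ->]].
    apply: (subseq_uniq _ (uniq_first_column_hooks pk)).
    apply: map_subseq; rewrite -[X in iota 0 X](subnKC ik) iotaD.
    exact: suffix_subseq.
  rewrite mem_iota in ii'; rewrite mem_filter mem_iota /=.
  have ik' : i' < size kappa by lia.
  have -> : hook_length kappa i' 0 \in first_column_hooks kappa.
    by apply: map_f; rewrite mem_iota.
  rewrite hE first_column_hook //=.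
  have ii : i <= i' by lia.
  by have := sorted_geq_nth sk ii; lia.
have := count_predC (mem (first_column_hooks kappa)) (iota 0 h).
rewrite size_map !size_iota size_filter hE.
rewrite (@eq_count _ (fun g => g \notin _)
                     (predC (mem (first_column_hooks kappa)))) //; lia.
Qed.

Lemma boundary_boxesE m kappa i : is_partition kappa -> i < size kappa ->
  let h := hook_length kappa i 0 in
  boundary_boxes m kappa i =
  count (fun g => (g \notin first_column_hooks kappa) && (h < g + m))
        (iota 0 h).
Proof.
move=> pk ik h; rewrite /boundary_boxes.
rewrite -(count_map _ (fun x => x < m)) (permP (perm_row_hooks pk ik)).
rewrite count_map count_filter; apply: eq_in_count => g.
by rewrite mem_iota /= -/h andbC => gh; congr andb; lia.
Qed.

(** When the complement of the first-column hooks is closed under adding [m], a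
    first-column hook is the largest of its class as soon as the next number in
    the class is missing. *)
Lemma m_row_hooks m kappa : 0 < m ->
  (forall g, g \notin first_column_hooks kappa ->
     g + m \notin first_column_hooks kappa) ->
  [seq hook_length kappa i 0 | i <- m_rows m kappa]
  = [seq h <- first_column_hooks kappa | h + m \notin first_column_hooks kappa].
Proof.
move=> m_gt0 closed; rewrite [in RHS]/first_column_hooks filter_map; congr map.
rewrite /m_rows; apply: eq_in_filter => i; rewrite mem_iota /= => ik.
rewrite -/(first_column_hooks kappa).
set F := first_column_hooks kappa in closed *; set h := hook_length kappa i 0.
apply/allP/idP => [big|hF i' i'k].
  apply/negP => /mapP[i' i'k e].
  by have := big _ i'k; rewrite -e modnDr eqxx /=; lia.
apply/implyP; rewrite eq_sym => /eqP hh; rewrite leqNgt; apply/negP => lt.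
have : hook_length kappa i' 0 \in F by apply: map_f.
have [t ->] : exists t, hook_length kappa i' 0 = h + m + t * m.
  move/eqP: hh; rewrite eq_sym eqn_mod_dvd; last by rewrite ltnW.
  by case/dvdnP=> [[|t] e]; [exfalso; lia | exists t; lia].
by apply/negP; apply: (closed_iter (p := fun g => g \notin F)).
Qed.

(** * Moves of the bounce path *)

Lemma size_vertical_moves Q m : size (vertical_moves Q m) = m.
Proof. by elim: m => //= m IH; rewrite size_rcons IH. Qed.

Lemma horizontal_moves_rcons m v l : m <= size v ->
  horizontal_moves m (rcons v l) = horizontal_moves m v.
Proof.
move=> mv; apply/eq_in_map => i; rewrite mem_iota => im.
rewrite -cats1 take_cat; case: ltnP => // vi.
by rewrite (_ : i = size v) ?subnn ?take_size ?cats0 //; lia.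
Qed.

Lemma horizontal_movesS m v :
  horizontal_moves m.+1 v = rcons (horizontal_moves m v) (sumn (take m.+1 v)).
Proof.
by rewrite /horizontal_moves -(addn1 m) iotaD map_cat cats1 add1n addn1.
Qed.

(** * Levels of a Dyck path and their hooks *)

Lemma modn_mul_inj m c x x' : coprime m c -> x < m -> x' < m ->
  c * x = c * x' %[mod m] -> x = x'.
Proof.
move=> co; wlog xx : x x' / x <= x' => [H xm xm' e|xm xm' /esym/eqP].
  by case: (leqP x x') => [|/ltnW] xx; [apply: H | apply/esym/H].
rewrite eqn_mod_dvd ?leq_mul2l ?xx ?orbT // -mulnBr Gauss_dvdr // => d.
by case: (posnP (x' - x)) => [|/dvdn_leq/(_ d)]; lia.
Qed.

Section DyckPath.
Variables (a b : nat) (w : seq step).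
Hypotheses (a_gt0 : 0 < a) (b_gt0 : 0 < b) (co_ab : coprime a b).
Hypothesis dyck_w : dyck_path a b w.

Local Notation abscissa y := (nth 0 (north_abscissas w) y).
Local Notation height x := (nth 0 (east_heights w) x).

(** The complement of the positive hooks among the natural numbers; together
    with the negative integers, the hooks are the beads of the abacus of the
    core. *)
Definition gap : pred nat := fun g => g \notin positive_hooks a b w.

Definition north_levels : seq nat :=
  [seq b * y - a * abscissa y | y <- iota 0 a].

(** Levels at which east steps end. They are used instead of the levels at which
    east steps start, which are larger by [a], because they are gaps. *)
Definition east_ends : seq nat :=
  [seq b * height x - a * x.+1 | x <- iota 0 b].

Lemma north_count : count_mem North w = a.
Proof. by case/and3P: dyck_w => /eqP. Qed.

Lemma east_count : count_mem East w = b.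
Proof. by case/and3P: dyck_w => _ /eqP. Qed.

Lemma dyck_point i : i <= size w -> a * (point w i).1 <= b * (point w i).2.
Proof.
case/and3P: dyck_w => _ _ /allP dw iw; apply: dw.
by rewrite mem_iota /= add0n ltnS.
Qed.

Lemma north_level_ge0 y : y < a -> a * abscissa y <= b * y.
Proof.
move=> ya; have yw : y < count_mem North w by rewrite north_count.
have : (abscissa y, y) \in step_points North w.
  by rewrite -nth_north_points // mem_nth ?size_step_points.
case/mapP=> i; rewrite mem_filter mem_iota => /= /andP[_ iw] e.
by have := dyck_point (ltnW iw); rewrite -e.
Qed.

Lemma east_end_ge0 x : x < b -> a * x.+1 <= b * height x.
Proof.
move=> xb; have xw : x < count_mem East w by rewrite east_count.
have : (x, height x) \in step_points East w.
  by rewrite -nth_east_points // mem_nth ?size_step_points.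
case/mapP=> i; rewrite mem_filter mem_iota => /= /andP[/eqP ei iw] [ex ey].
have := dyck_point iw; rewrite /point (take_nth East) // ei.
by rewrite -!cats1 !count_cat /= !addn0 addn1 -ex -ey.
Qed.

Lemma height_gt y x : y < a -> x < b -> (y < height x) = (abscissa y <= x).
Proof.
by move=> ya xb; rewrite north_east_transpose ?north_count ?east_count.
Qed.

Lemma height_leq x : x < b -> height x <= a.
Proof.
move=> xb; rewrite nth_east_heights ?east_count //.
by rewrite (leq_trans (count_size _ _)) // size_north_abscissas north_count.
Qed.

Lemma height_mono x x' : x <= x' -> x' < b -> height x <= height x'.
Proof.
move=> xx xb; rewrite !nth_east_heights ?east_count //; last first.
  exact: leq_ltn_trans xb.
by apply: sub_count => z /= zx; apply: leq_trans xx.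
Qed.

(** Filling the rows 0, ..., a - 1 extended to infinity with their levels, each
    integer occurs at most once; the equation is by - ax = by' - ax' written
    without subtraction. *)
Lemma level_inj y y' x x' : y < a -> y' < a ->
  b * y + a * x' = b * y' + a * x -> y = y' /\ x = x'.
Proof.
suff H z z' u u' : z <= z' -> z' < a -> b * z + a * u' = b * z' + a * u ->
    z = z' /\ u = u'.
  case: (leqP y y') => [yy _ ya e|/ltnW yy ya _ e].
    exact: (H _ _ _ _ yy ya e).
  by have [-> ->] := H _ _ _ _ yy ya (esym e).
move=> zz za e; have lt : z' - z < a by lia.
have e' : b * (z' - z) + a * u = a * u' by rewrite mulnBr; nia.
have : a %| z' - z.
  rewrite -(Gauss_dvdr _ co_ab) -(dvdn_addl _ (dvdn_mulr u (dvdnn a))).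
  by rewrite e' dvdn_mulr.
move/dvdn_leq => d; have zE : z = z' by case: (posnP (z' - z)) => [|/d]; lia.
split=> //; apply/eqP; rewrite -(eqn_pmul2l a_gt0); apply/eqP.
by rewrite zE subnn muln0 in e'.
Qed.

Lemma mem_positive_hooks h :
  reflect [/\ 0 < h & exists x y,
             [/\ x < b, y < height x & h + a * x.+1 = b * y]]
    (h \in positive_hooks a b w).
Proof.
apply: (iffP mapP) => [[[x y]]|[h_gt0 [x [y [xb yx e]]]]].
  rewrite !mem_filter /level /= => /and3P[lv yx].
  case/allpairsP=> [[x' y']] /=; rewrite !mem_iota => -[xb ya [? ?]].
  subst x' y'.
  move=> ->; split; first lia.
  by case: x lv yx xb => // x lv yx xb; exists x, y; split=> //; lia.
exists (x.+1, y); last by rewrite /level /=; lia.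
rewrite !mem_filter /level /= yx andTb; apply/andP; split; first lia.
apply/allpairsP; exists (x.+1, y); rewrite !mem_iota /=; split=> //.
have := height_leq xb; lia.
Qed.

Lemma uniq_positive_hooks : uniq (positive_hooks a b w).
Proof.
rewrite map_inj_in_uniq; last first.
  move=> [x y] [x' y']; rewrite !mem_filter /level /=.
  case/and3P=> lv _ /allpairsP[[x1 y1] /=]; rewrite !mem_iota => -[xb ya [? ?]].
  subst x1 y1.
  case/and3P=> lv' _ /allpairsP[[x1 y1] /=].
  rewrite !mem_iota => -[xb' ya' [? ?]].
  subst x1 y1.
  move=> e; have [] := @level_inj y y' x x' _ _ _; try lia.
  by move=> -> ->.
rewrite !filter_uniq // allpairs_uniq ?iota_uniq //.
by move=> -[? ?] [? ?] _ _ [-> ->].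
Qed.

Lemma positive_hooks_gt0 : all (leq 1) (positive_hooks a b w).
Proof. by apply/allP => h /mem_positive_hooks[]. Qed.

Lemma gap0 : gap 0.
Proof. by apply/negP => /mem_positive_hooks[]. Qed.

(** If g + [a] is the hook of a box, then g is the hook of its right
    neighbour. *)
Lemma gap_add_a g : gap g -> gap (g + a).
Proof.
apply: contra => /mem_positive_hooks[_ [x [y [xb yx e]]]].
have ya : y < a by have := height_leq xb; lia.
have xb' : x.+1 < b.
  rewrite -(ltn_pmul2l a_gt0); have : b * y < b * a by rewrite ltn_pmul2l.
  nia.
have e' : g + a * x.+2 = b * y by lia.
case: (posnP g) => [g0|g_gt0].
  have [] := @level_inj y 0 x.+2 0 ya a_gt0; first by lia.
  by [].
apply/mem_positive_hooks; split=> //; exists x.+1, y; split=> //.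
by apply: leq_trans (height_mono (leqnSn x) xb').
Qed.

(** If g + [b] is the hook of a box, then g is the hook of the box below it. *)
Lemma gap_add_b g : gap g -> gap (g + b).
Proof.
apply: contra => /mem_positive_hooks[_ [x [y [xb yx e]]]].
have ya : y < a by have := height_leq xb; lia.
have y_gt0 : 0 < y by case: (y) e; lia.
have e' : g + a * x.+1 = b * y.-1 by case: (y) y_gt0 e => // y' _; lia.
case: (posnP g) => [g0|g_gt0].
  have [] := @level_inj y.-1 0 x.+1 0; lia.
apply/mem_positive_hooks; split=> //; exists x, y.-1; split=> //; lia.
Qed.

(** The box to the right of a north step, if its level is positive, has the
    largest hook of its row, and that hook is [a] less than the level at which
    the step starts. *)
Lemma north_first y : y < a -> first_in_class a gap (b * y - a * abscissa y).
Proof.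
move=> ya; have nl := north_level_ge0 ya; apply/andP; split.
  apply/negP => /mem_positive_hooks[_ [x [y' [xb yx e]]]].
  have ya' : y' < a by have := height_leq xb; lia.
  have [] := @level_inj y y' (abscissa y) x.+1 ya ya'; first by lia.
  by move=> ? ex; subst y'; rewrite height_gt // ex ltnn in yx.
apply/implyP => al; apply/negPn/mem_positive_hooks.
have xb : abscissa y < b.
  rewrite -(ltn_pmul2l a_gt0); have : b * y < b * a by rewrite ltn_pmul2l.
  nia.
have e : b * y - a * abscissa y - a + a * (abscissa y).+1 = b * y by lia.
split; last by exists (abscissa y), y; rewrite height_gt.
rewrite lt0n; apply/eqP => n0; rewrite n0 in e.
have [] := @level_inj y 0 (abscissa y).+1 0 ya a_gt0; first by lia.
by [].
Qed.

(** The box under an east step has the largest level of its column, and that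
    level is [b] less than the level at which the step ends. *)
Lemma east_first x : x < b -> first_in_class b gap (b * height x - a * x.+1).
Proof.
move=> xb; have el := east_end_ge0 xb; have hx := height_leq xb.
apply/andP; split.
  apply/negP => /mem_positive_hooks[_ [x' [y' [xb' yx e]]]].
  have ya' : y' < a by have := height_leq xb'; lia.
  case: (ltnP (height x) a) => ha.
    have [] := @level_inj (height x) y' x.+1 x'.+1 ha ya'; first by lia.
    by move=> hy [ex]; rewrite -hy -ex ltnn in yx.
  (* An east step on the top line of the grid: its level is also that of a point
     of the bottom line, [b] columns to the left. *)
  have {ha}hE : height x = a by lia.
  have [] := @level_inj 0 y' 0 (x'.+1 + b - x.+1) a_gt0 ya'; nia.
apply/implyP => bl; apply/negPn/mem_positive_hooks.
have h_gt0 : 0 < height x by case: (height x) el bl; lia.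
have e : b * height x - a * x.+1 - b + a * x.+1 = b * (height x).-1.
  by case: (height x) h_gt0 el bl => // h _; lia.
split; last by exists x, (height x).-1; split=> //; lia.
rewrite lt0n; apply/eqP => n0; rewrite n0 in e.
have [] := @level_inj (height x).-1 0 x.+1 0; lia.
Qed.

Lemma uniq_north_residues : uniq [seq n %% a | n <- north_levels].
Proof.
rewrite -map_comp map_inj_in_uniq ?iota_uniq // => y y'.
rewrite !mem_iota => ya ya' /= e.
apply: (@modn_mul_inj a b) => //.
rewrite -(subnK (north_level_ge0 ya)) -[in RHS](subnK (north_level_ge0 ya')).
have M m c : m + a * c = m %[mod a] by rewrite addnC mulnC modnMDl.
by rewrite !M.
Qed.

Lemma uniq_east_residues : uniq [seq e %% b | e <- east_ends].
Proof.
rewrite -map_comp map_inj_in_uniq ?iota_uniq // => x x'.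
rewrite !mem_iota => xb xb' /= e.
apply: (@modn_mul_inj b a) => //; first by rewrite coprime_sym.
apply/eqP; rewrite -(eqn_modDl a) -!mulnS.
move/eqP: e; rewrite -(eqn_modDr (a * x.+1 + a * x'.+1)).
rewrite addnA subnK ?east_end_ge0 //.
rewrite [X in _ == _ + X %[mod b]]addnC addnA subnK ?east_end_ge0 //.
by rewrite ![b * _]mulnC !modnMDl eq_sym.
Qed.

Lemma mem_north_levels n : (n \in north_levels) = first_in_class a gap n.
Proof.
apply: firsts_complete => //; first exact: gap_add_a.
- by rewrite size_map size_iota.
- exact: uniq_north_residues.
by apply/allP => _ /mapP[y yr ->]; apply: north_first; rewrite mem_iota in yr.
Qed.

Lemma mem_east_ends e : (e \in east_ends) = first_in_class b gap e.
Proof.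
apply: firsts_complete => //; first exact: gap_add_b.
- by rewrite size_map size_iota.
- exact: uniq_east_residues.
by apply/allP => _ /mapP[x xr ->]; apply: east_first; rewrite mem_iota in xr.
Qed.

Lemma uniq_north_levels : uniq north_levels.
Proof. exact: map_uniq uniq_north_residues. Qed.

Lemma uniq_east_ends : uniq east_ends.
Proof. exact: map_uniq uniq_east_residues. Qed.

(** Among the gaps at distance less than [b] below a hook h there is one for
    each residue class modulo [b] that has a gap below h. *)
Lemma count_gaps_near h : h \in positive_hooks a b w ->
  count (fun g => gap g && (h < g + b)) (iota 0 h) = count (ltn^~ h) east_ends.
Proof.
move=> hH.
(* The number h - b is not a gap, since h is not. *)
have -> : count (fun g => gap g && (h < g + b)) (iota 0 h)
        = count (fun g => gap g && (h <= g + b)) (iota 0 h).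
  apply: eq_count => g; case gg: (gap g) => //=; case: ltngtP => // hg.
  by move/negP: (gap_add_b gg); rewrite -hg.
case: (leqP h b) => hb.
  rewrite -(count_below uniq_east_ends mem_east_ends) //.
  by apply: eq_count => g; rewrite (leq_trans hb) ?leq_addl ?andbT.
have [x ->] : exists x, h = x + b by exists (h - b); lia.
have := count_window gap_add_b uniq_east_ends mem_east_ends x.
rewrite iotaD !count_cat => /eqP; rewrite eqn_add2l => /eqP <-.
rewrite (@eq_in_count _ _ pred0 (iota 0 x)); last first.
  move=> g; rewrite mem_iota leq_add2r /= => gx.
  by rewrite [_ <= g]leqNgt gx andbF.
rewrite count_pred0; apply: eq_in_count => g; rewrite mem_iota leq_add2r.
by case/andP=> -> _; rewrite andbT.
Qed.

Lemma core_partition : is_partition (core a b w).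
Proof.
by case: (partition_of_hooksP uniq_positive_hooks positive_hooks_gt0).
Qed.

Lemma perm_core_hooks :
  perm_eq (first_column_hooks (core a b w)) (positive_hooks a b w).
Proof.
by case: (partition_of_hooksP uniq_positive_hooks positive_hooks_gt0).
Qed.

Lemma notin_core_hooks g : (g \notin first_column_hooks (core a b w)) = gap g.
Proof. by rewrite (perm_mem perm_core_hooks). Qed.

(** A hook h is the largest of its class modulo [a] when h + [a] is a gap, which
    is then the smallest gap of the class, hence a north level. *)
Lemma perm_a_row_hooks :
  perm_eq [seq hook_length (core a b w) i 0 | i <- m_rows a (core a b w)]
          [seq n - a | n <- north_levels & a < n].
Proof.
rewrite m_row_hooks // => [|g]; last first.
  by rewrite !notin_core_hooks; apply: gap_add_a.
apply: uniq_perm.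
- by rewrite filter_uniq ?uniq_first_column_hooks ?core_partition.
- rewrite map_inj_in_uniq ?filter_uniq ?uniq_north_levels // => n n'.
  by rewrite !mem_filter; lia.
move=> h; rewrite mem_filter notin_core_hooks (perm_mem perm_core_hooks).
apply/andP/mapP=> [[gh hH]|[n]].
  have h_gt0 : 0 < h by case/mem_positive_hooks: hH.
  exists (h + a); last by rewrite addnK.
  rewrite mem_filter mem_north_levels /first_in_class gh leq_addl addnK.
  by rewrite /gap hH; lia.
rewrite mem_filter mem_north_levels.
case/andP=> an /andP[gn /implyP/(_ (ltnW an))].
by rewrite negbK => nH ->; rewrite subnK // ltnW.
Qed.

(** This is the sweep property of [zeta]: an east end below n - [a] is the end
    of an east step that starts below n, so each north step of P of level n gives a
    north step of [zeta] preceded by the east steps of P of level below n. The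
    north levels up to [a] account for the padding by zeros. *)
Lemma perm_lambda :
  perm_eq (lambda a b w)
          [seq count (ltn^~ (n - a)) east_ends | n <- north_levels].
Proof.
have E : [seq boundary_boxes b (core a b w) i | i <- m_rows a (core a b w)]
  = [seq count (ltn^~ h) east_ends |
       h <- [seq hook_length (core a b w) i 0 | i <- m_rows a (core a b w)]].
  rewrite -map_comp; apply/eq_in_map => i.
  rewrite mem_filter mem_iota => /andP[_ ik].
  rewrite boundary_boxesE ?core_partition // [RHS]/comp -count_gaps_near.
    by apply: eq_count => g; rewrite notin_core_hooks.
  rewrite -(perm_mem perm_core_hooks); apply: map_f.
  by rewrite mem_iota.
set s := [seq boundary_boxes _ _ _ | _ <- _] in E.
have ps : perm_eq s
    [seq count (ltn^~ (n - a)) east_ends | n <- north_levels & a < n].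
  have := perm_map (fun h => count (ltn^~ h) east_ends) perm_a_row_hooks.
  by rewrite -E -[X in perm_eq _ X]map_comp.
rewrite /lambda -/s size_sort.
pose f n := count (ltn^~ (n - a)) east_ends; rewrite -/f.
have pc := perm_map f (permEl (perm_filterC (ltn a) north_levels)).
rewrite -(permPr pc) map_cat; apply: perm_cat; first by rewrite perm_sort.
have /all_pred1P -> :
    all (pred1 0) [seq f n | n <- north_levels & predC (ltn a) n].
  apply/allP => y /mapP[n]; rewrite mem_filter /= -leqNgt => /andP[na _] ->.
  by rewrite /f (eqP na); elim: (east_ends).
have := perm_size pc.
rewrite map_cat size_cat -(perm_size ps) !size_map size_iota.
by move=> e; rewrite -[X in nseq (X - _)]e addKn.
Qed.

Lemma size_lambda : size (lambda a b w) = a.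
Proof. by rewrite (perm_size perm_lambda) !size_map size_iota. Qed.

Lemma sorted_lambda : sorted geq (lambda a b w).
Proof.
have geq_tr : transitive geq by move=> x y z /= xy yz; apply: leq_trans yz xy.
rewrite /lambda; set s := sort _ _; rewrite sorted_pairwise // pairwise_cat.
apply/and3P; split.
- by apply/allrelP => x y _ /nseqP[-> _].
- by rewrite -sorted_pairwise //; apply: sort_sorted => x y; apply: leq_total.
by rewrite -sorted_pairwise //; elim: (_ - _) => //= -[|n].
Qed.

Lemma zeta_path :
  [/\ count_mem North (zeta a b w) = a, count_mem East (zeta a b w) = b
    & north_abscissas (zeta a b w) = rev (lambda a b w)].
Proof.
have [|q1 q2 q3] := @north_abscissas_path b _ sorted_lambda.
  apply/allP => l; rewrite (perm_mem perm_lambda) => /mapP[n _ ->].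
  by rewrite (leq_trans (count_size _ _)) // size_map size_iota.
by rewrite size_lambda in q1.
Qed.

Lemma height_zeta j : j < b ->
  nth 0 (east_heights (zeta a b w)) j =
  count (fun n => count (ltn^~ (n - a)) east_ends <= j) north_levels.
Proof.
case: zeta_path => _ qb qa jb; rewrite nth_east_heights ?qb // qa.
by rewrite (permP (permEl (perm_rev _))) (permP perm_lambda) count_map.
Qed.

(** * The bounce path *)

Definition gaps_below x := count gap (iota 0 x).
Definition norths_below x := count (ltn^~ x) north_levels.

Lemma gap_mul i : gap (a * i).
Proof.
by rewrite mulnC -[_ * a]add0n; apply: (closed_iter gap_add_a i gap0).
Qed.

Lemma mul_not_north i : a * i.+1 \notin north_levels.
Proof.
by rewrite mem_north_levels /first_in_class gap_mul mulnS leq_addr addKn gap_mul.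
Qed.

Lemma gaps_below_mulS i :
  gaps_below (a * i.+1) = gaps_below (a * i) + norths_below (a * i.+1).
Proof.
rewrite mulnS addnC.
exact: (count_window gap_add_a uniq_north_levels mem_north_levels).
Qed.

Lemma gaps_below_east x : x <= b -> gaps_below x = count (ltn^~ x) east_ends.
Proof. exact: (count_below uniq_east_ends mem_east_ends). Qed.

Lemma mul_east_end i : a * i < b -> a * i \in east_ends.
Proof.
by move=> ib; rewrite mem_east_ends /first_in_class gap_mul leqNgt ib.
Qed.

Lemma gaps_below_ltn i : a * i < b -> gaps_below (a * i) < b.
Proof.
move=> ib; rewrite gaps_below_east ?(ltnW ib) //.
have bE : b = size east_ends by rewrite size_map size_iota.
rewrite [ltnRHS]bE -(count_predC (ltn^~ (a * i))) -[ltnLHS]addn0.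
rewrite ltn_add2l -has_count; apply/hasP.
by exists (a * i); rewrite ?mul_east_end //= ltnn.
Qed.

(** The east step of P ending at level [a * i] is preceded, by increasing level,
    by as many east steps as there are gaps below [a * i], because gaps below
    [b] are smallest in their classes modulo [b]. It starts at level [a * i.+1], so
    the north steps preceding it are those of smaller level. *)
Lemma zeta_height_gaps i : a * i < b ->
  nth 0 (east_heights (zeta a b w)) (gaps_below (a * i))
  = norths_below (a * i.+1).
Proof.
move=> ib; rewrite height_zeta ?gaps_below_ltn // gaps_below_east ?(ltnW ib) //.
apply: eq_in_count => n nN /=.
have nai : n != a * i.+1 by apply: contraTneq nN => ->; apply: mul_not_north.
case: (ltngtP n (a * i.+1)) nai => // ni _; last first.
  apply/negbTE; rewrite -ltnNge.
  have : count (ltn^~ (a * i).+1) east_ends <= count (ltn^~ (n - a)) east_ends.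
    by apply: sub_count => e /=; lia.
  apply: leq_trans; rewrite (count_ltnS uniq_east_ends mem_east_ends).
  by rewrite -mem_east_ends mul_east_end // addn1.
by apply: sub_count => e' /=; lia.
Qed.

Lemma norths_below_mono x y : x <= y -> norths_below x <= norths_below y.
Proof. by move=> xy; apply: sub_count => n /=; lia. Qed.

(** The i-th horizontal move is as long as the first i vertical moves together,
    that is, as the number of north levels below [a * i], which is also the
    number of gaps that are at least [a * i.-1] and less than [a * i]. *)
Lemma bounce_path m : (forall i, i < m -> a * i < b) ->
  sumn (vertical_moves (zeta a b w) m) = norths_below (a * m) /\
  sumn (horizontal_moves m (vertical_moves (zeta a b w) m))
  = gaps_below (a * m).
Proof.
elim: m => [|m IH] mb.
  by rewrite muln0; split=> //; rewrite /norths_below; elim: (north_levels).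
have [|IHv IHh] := IH; first by move=> i im; apply: mb; apply: ltnW.
rewrite [vertical_moves _ m.+1]/=; set v := vertical_moves _ m in IHv IHh *.
have sv : size v = m by apply: size_vertical_moves.
rewrite IHh zeta_height_gaps ?mb // IHv.
set u := rcons v _.
have su : sumn u = norths_below (a * m.+1).
  rewrite sumn_rcons IHv subnKC // norths_below_mono //.
  by rewrite leq_mul2l leqnSn orbT.
split=> //; rewrite horizontal_movesS horizontal_moves_rcons ?sv //.
by rewrite sumn_rcons IHh take_oversize ?size_rcons ?sv // su gaps_below_mulS.
Qed.

Lemma levels_perm :
  perm_eq (levels a b w)
          [seq Posz l | l <- north_levels ++ [seq e + a | e <- east_ends]].
Proof.
have -> : levels a b w
    = [seq level a b p | p <- [seq point w i | i <- iota 0 (size w)]].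
  by rewrite -map_comp.
rewrite (permPl (perm_map _ (perm_step_points w))) !map_cat.
have -> : step_points North w = [seq (abscissa y, y) | y <- iota 0 a].
  apply: (@eq_from_nth _ (0, 0)) => [|y]; rewrite size_step_points north_count.
    by rewrite size_map size_iota.
  move=> ya; rewrite nth_north_points ?north_count // (nth_map 0) ?size_iota //.
  by rewrite nth_iota.
have -> : step_points East w = [seq (x, height x) | x <- iota 0 b].
  apply: (@eq_from_nth _ (0, 0)) => [|x]; rewrite size_step_points east_count.
    by rewrite size_map size_iota.
  move=> xb; rewrite nth_east_points ?east_count // (nth_map 0) ?size_iota //.
  by rewrite nth_iota.
rewrite -!map_comp; apply/permP => q; congr (count q (_ ++ _)).
  apply/eq_in_map => y; rewrite mem_iota => /= ya.
  by rewrite /level /=; have := north_level_ge0 ya; lia.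
apply/eq_in_map => x; rewrite mem_iota => /= xb.
by rewrite /level /=; have := east_end_ge0 xb; lia.
Qed.

(** North levels are distinct, east levels are distinct, and an east level minus
    [a] is a gap, which a north level minus [a] is not. *)
Lemma uniq_levels : uniq (levels a b w).
Proof.
rewrite (perm_uniq levels_perm) map_inj_uniq; last by move=> x y [].
rewrite cat_uniq uniq_north_levels map_inj_uniq; last exact: addIn.
rewrite uniq_east_ends andbT.
apply/hasPn => _ /mapP[e eE ->]; rewrite mem_north_levels /first_in_class.
move: eE; rewrite mem_east_ends => /andP[ge _].
by rewrite leq_addl addnK ge andbF.
Qed.

(** As [a * k.+1] is not a north level, [norths_below] counts the north levels
    up to it. The east levels up to it correspond to the east ends up to [a * k],
    that is, since [a * k] < [b], to all the gaps up to [a * k]; the gap [a * k]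
    itself accounts for the 1. *)
Lemma count_levels_leq k : a * k < b ->
  count (fun l : int => (l <= (a * k.+1)%N%:Z)%R) (levels a b w)
  = norths_below (a * k.+1) + gaps_below (a * k) + 1.
Proof.
move=> kb; rewrite (permP levels_perm) count_map count_cat -addnA.
congr (_ + _).
  apply: eq_in_count => n nN /=; rewrite lez_nat leq_eqVlt.
  suff -> : (n == a * k.+1) = false by [].
  by apply: contraTF nN => /eqP ->; apply: mul_not_north.
have -> : gaps_below (a * k) + 1 = gaps_below (a * k).+1.
  by rewrite /gaps_below count_iotaS gap_mul.
rewrite gaps_below_east // count_map; apply: eq_count => e /=.
by rewrite lez_nat mulnS; lia.
Qed.

End DyckPath.

Lemma count_int_interval (s : seq int) (m r : nat) : uniq s ->
  count (fun l : int => (m%:Z < l < (m + r.+1)%N%:Z)%R) s <= r.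
Proof.
move=> us; rewrite -size_filter -[leqRHS](size_iota m.+1).
rewrite -[leqRHS](size_map Posz).
apply: uniq_leq_size => [|l]; first exact: filter_uniq.
rewrite mem_filter => /andP[/= /andP[ml lm] _].
apply/mapP; exists (absz l); last lia.
by rewrite mem_iota; lia.
Qed.

Theorem proposition9p13 (a k r : nat) (P : seq step)
    (r_gt0 : 0 < r) (r_lt_a : r < a) (co_a_r : coprime a r)
    (dyckP : dyck_path a (a * k + r) P) :
  let b := a * k + r in
  let Q := zeta a b P in
  let v := vertical_moves Q k.+1 in
  let h := horizontal_moves k v in
  delta_tilde a b k P = sumn v + sumn h + 1 /\
  sumn v + sumn h + 1 <= delta a b P <= sumn v + sumn h + r.
Proof.
move=> b Q v h.
have a_gt0 : 0 < a by apply: ltn_trans r_lt_a.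
have b_gt0 : 0 < b by rewrite addn_gt0 r_gt0 orbT.
have co_ab : coprime a b by rewrite /coprime /b mulnC gcdnMDl.
have ib i : i <= k -> a * i < b.
  by move=> ik; rewrite /b -addn1 leq_add // leq_mul2l ik orbT.
have [sv _] := bounce_path a_gt0 b_gt0 co_ab dyckP (m := k.+1) ib.
have [|_ sh] := bounce_path a_gt0 b_gt0 co_ab dyckP (m := k).
  by move=> i /ltnW; apply: ib.
have hE : h = horizontal_moves k (vertical_moves Q k).
  by rewrite /h /v /= horizontal_moves_rcons ?size_vertical_moves.
have dt : delta_tilde a b k P = sumn v + sumn h + 1.
  by rewrite /delta_tilde count_levels_leq ?ib // hE sv sh.
split=> //; rewrite -dt /delta /delta_tilde.
have dE : count (fun l : int => (l < (a + b)%N%:Z)%R) (levels a b P)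
   = delta_tilde a b k P
   + count (fun l : int =>
              ((a * k.+1)%N%:Z < l < (a * k.+1 + r.-1.+1)%N%:Z)%R)
           (levels a b P).
  rewrite -count_predUI (eq_count (a2 := pred0) (a1 := predI _ _)).
    rewrite count_pred0 addn0; apply: eq_count => l /=; rewrite /b; lia.
  by move=> l /=; apply/negP => /and3P[]; lia.
have := @count_int_interval _ (a * k.+1) r.-1
  (uniq_levels a_gt0 b_gt0 co_ab dyckP).
rewrite dE -/(delta_tilde a b k P) => ci; lia.
Qed.
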